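(* Let $p$ be a prime with $p\equiv 1 \bmod 4$ and let $G$ denote the Paley graph of order $p$. Then the size $\omega(G)$ of the largest clique in $G$ satisfies $\omega(G)<\sqrt{p}$.
   Context: The Paley graph of prime order $p\equiv1\bmod 4$ is the simple graph with vertex set $\mathbb{Z}_p$ in which distinct vertices $n,n'$ are adjacent if and only if $n'-n$ is a nonzero quadratic residue modulo $p$. *)

(* Defs.v *)
From mathcomp Require Import all_boot all_order all_algebra all_fingroup all_solvable all_field.
Set Implicit Arguments. Unset Strict Implicit. Unset Printing Implicit Defensive.
Import GRing.Theory.
Local Open Scope ring_scope.

Record sgraph := SGraph {
  vertex :> finType;
  adj : rel vertex;
  adj_sym : symmetric adj;
  adj_irrefl : irreflexive adj }.

Definition clique (G : sgraph) (S : {set G}) : bool :=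
  [forall x in S, forall y in S, (x != y) ==> adj x y].

Definition clique_number (G : sgraph) : nat :=
  (\max_(S : {set G} | clique S) #|S|)%N.

Definition quadratic_residue (p : nat) (a : 'F_p) : bool :=
  [exists b : 'F_p, b ^+ 2 == a].

(* 'F_p is Z/pZ only for p prime; [Paley] below carries the primality proof. *)
Definition paley_adj (p : nat) : rel 'F_p :=
  fun n n' => (n != n') && ((n' - n != 0) && quadratic_residue (n' - n)).

Lemma sqrt_m1_Fp (p : nat) (p_prime : prime p) (p_mod4 : (p = 1 %[mod 4])%N) :
  exists i : 'F_p, i ^+ 2 = -1.
Proof.
have p1_gt0 : (0 < p.-1)%N by rewrite -ltnS prednK ?prime_gt1 ?prime_gt0.
have d4 : (4 %| p.-1)%N.
  by rewrite -subn1 -eqn_mod_dvd ?prime_gt0 //; apply/eqP.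
pose rs := enum (predC1 (0 : 'F_p)).
have sz : size rs = p.-1 by rewrite -cardE cardC1 card_Fp.
have rs_unity : all p.-1.-unity_root rs.
  apply/allP => x; rewrite mem_enum => x0.
  apply/unity_rootP; have := expf_card x; rewrite card_Fp // => xp.
  by apply: (mulfI x0); rewrite -exprS prednK ?prime_gt0 // mulr1.
have /hasP[z _ zP] : has p.-1.-primitive_root rs.
  by apply: has_prim_root => //; rewrite ?enum_uniq ?sz.
have /dvdnP[k kE] := d4.
have k0 : (0 < k)%N by case: k kE p1_gt0 => // ->.
exists (z ^+ k).
have : (z ^+ k ^+ 2) ^+ 2 == 1.
  by rewrite -(exprM z) -(exprM z) -mulnA -kE (prim_expr_order zP).
rewrite sqrf_eq1 => /orP[|/eqP //].
rewrite -exprM -(prim_order_dvd zP) kE => /dvdn_leq.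
by rewrite muln_gt0 k0 leq_pmul2l // => /(_ isT).
Qed.

Lemma paley_adj_sym (p : nat) (p_prime : prime p) (p_mod4 : (p = 1 %[mod 4])%N) :
  symmetric (@paley_adj p).
Proof.
have [i iE] := sqrt_m1_Fp p_prime p_mod4.
have qrN (a : 'F_p) : quadratic_residue a -> quadratic_residue (- a).
  case/existsP => b /eqP bE; apply/existsP; exists (i * b).
  by rewrite exprMn iE bE mulN1r.
move=> x y; rewrite /paley_adj eq_sym -(opprB x y) oppr_eq0.
congr (_ && (_ && _)); apply/idP/idP => /qrN //.
by rewrite opprK.
Qed.

Lemma paley_adj_irrefl (p : nat) : irreflexive (@paley_adj p).
Proof. by move=> x; rewrite /paley_adj eqxx. Qed.

Definition Paley (p : nat) (p_prime : prime p) (p_mod4 : (p = 1 %[mod 4])%N) :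
  sgraph := SGraph (paley_adj_sym p_prime p_mod4) (@paley_adj_irrefl p).

(* Main.v *)
Require Import Defs.
From mathcomp Require Import all_boot all_order all_algebra.
Import Order.TTheory GRing.Theory Num.Theory.
Local Open Scope ring_scope.

(** If [t] is not a square modulo [p] and [S] is a clique, the map
    [(x, y) |-> x + t y] is injective on [S * S]: a collision with [y != y']
    would write [t] as the quotient [(x - x') / (y' - y)] of two squares.
    Hence [#|S| ^ 2 <= p], and equality is impossible because a prime is not
    a perfect square. *)

Lemma exists_nonresidue (p : nat) (p_prime : prime p) (p_odd : odd p) :
  exists t : 'F_p, ~~ quadratic_residue t.
Proof.
apply/existsP; rewrite -negb_forall; apply/negP => /forallP all_sq.
pose sq (b : 'F_p) := b ^+ 2.
(* On a finite type a surjective map is injective, but [1] and [-1] have the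
   same square. *)
have /image_injP sq_inj : #|image sq predT| == #|@predT 'F_p|.
  apply/eqP/eq_card => t; rewrite inE; apply/imageP.
  by have /existsP[b /eqP bE] := all_sq t; exists b.
have /eqP := sq_inj 1 (-1) isT isT (esym (sqrrN 1)).
rewrite -subr_eq0 opprK -[1 + 1]/(2%:R) -(dvdn_pcharf (pchar_Fp p_prime)).
rewrite dvdn_prime2 // => /eqP p2.
by rewrite p2 in p_odd.
Qed.

Lemma quadratic_residue_div (p : nat) (a b : 'F_p) :
  quadratic_residue a -> quadratic_residue b -> quadratic_residue (a / b).
Proof.
move=> /existsP[c /eqP <-] /existsP[d /eqP <-].
by apply/existsP; exists (c / d); rewrite expr_div_n.
Qed.

(** The exponent of [p] is even in [n ^ 2] but 1 in [p]. *)
Lemma prime_neq_square (p n : nat) : prime p -> (n ^ 2 != p)%N.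
Proof.
move=> p_prime; apply/eqP => nE.
by have := logn_prime p p_prime; rewrite -{2}nE lognX eqxx; case: (logn p n) => [|[]].
Qed.

(** Allowing [x = y], where the difference 0 is a square, spares the collision argument a separate
    case [x = x']. *)
Lemma clique_quadratic_residueB (p : nat) (p_prime : prime p)
    (p_mod4 : (p = 1 %[mod 4])%N) (S : {set Paley p_prime p_mod4})
    (x y : 'F_p) :
  clique S -> x \in S -> y \in S -> quadratic_residue (y - x).
Proof.
move=> /forall_inP S_clique xS yS.
have [->|xy] := eqVneq x y.
  by apply/existsP; exists 0; rewrite subrr expr0n.
have /forall_inP/(_ y yS)/implyP/(_ xy) := S_clique x xS.
by case/and3P.
Qed.

Lemma clique_card_sqr_lt (p : nat) (p_prime : prime p)
    (p_mod4 : (p = 1 %[mod 4])%N) (S : {set Paley p_prime p_mod4}) :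
  clique S -> (#|S| ^ 2 < p)%N.
Proof.
move=> S_clique; rewrite ltn_neqAle prime_neq_square //=.
have p_odd : odd p.
  by rewrite -(odd_mod p (erefl : odd 4 = false)) p_mod4.
have [t tN] := exists_nonresidue p p_prime p_odd.
pose f (u : 'F_p * 'F_p) := u.1 + t * u.2.
have f_inj : {in setX S S &, injective f}.
  move=> [x y] [x' y']; rewrite !inE /f /= => /andP[xS yS] /andP[x'S y'S] fE.
  have [yy'|y_neq] := eqVneq y y'.
    by move: fE; rewrite yy' => /addIr ->.
  case/negP: tN; have -> : t = (x - x') / (y' - y).
    apply: (canRL (mulfK _)); first by rewrite subr_eq0 eq_sym.
    apply/eqP; rewrite mulrBr subr_eq addrAC eq_sym subr_eq.
    by rewrite fE addrC.
  by apply: quadratic_residue_div;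
    apply: (clique_quadratic_residueB _ p_prime p_mod4 S).
(* [#|S| ^ 2] is the size of the image of [S * S] under [f], a subset of ['F_p]. *)
rewrite -mulnn -cardsX -(card_in_imset f_inj) -[leqRHS](card_Fp p_prime).
exact: max_card.
Qed.

Theorem theorem23 (R : rcfType) (p : nat) (p_prime : prime p)
    (p_mod4 : (p = 1 %[mod 4])%N) :
  (clique_number (Paley p_prime p_mod4))%:R < Num.sqrt (p%:R : R).
Proof.
have lt_p : (clique_number (Paley p_prime p_mod4) ^ 2 < p)%N.
  (* The bound passes to the maximum: it holds for the default value 0 and is stable under
     [maxn]. *)
  rewrite /clique_number; elim/big_ind: _ => [|m n m_lt n_lt|S].
  - exact: prime_gt0.
  - by rewrite /maxn; case: ifP.
  - exact: clique_card_sqr_lt.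
(* The clique number, being nonnegative, is the root of its square, so only the radicands need
   comparing. *)
rewrite -[ltLHS]ger0_norm ?ler0n // -sqrtr_sqr ltr_sqrt ?ltr0n ?prime_gt0 //.
by rewrite -natrX ltr_nat.
Qed.
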